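(* Let $0<p<1$, and for each $n\ge 1$ let $d^{(n)}(t)$ be the maximal total variation distance to stationarity and $t^{(n)}_{\mathrm{mix}}(\epsilon)$ the $\epsilon$-mixing time of the cyclic dynamics with parameter $p$ on $\Sigma_n=\{1,2,3\}^{\{1,\dots,n\}}$. Set $$t(n)=\frac{1}{3p}\,n\log n .$$ Then the cyclic dynamics exhibit cutoff at $t(n)$ with a window of size $O(n)$; that is, for every $\epsilon\in(0,1)$, $$\lim_{n\to\infty}\frac{t^{(n)}_{\mathrm{mix}}(\epsilon)}{t^{(n)}_{\mathrm{mix}}(1-\epsilon)}=1,$$ and $$\lim_{\alpha\to-\infty}\liminf_{n\to\infty}d^{(n)}\big(t(n)+\alpha n\big)=1,\qquad \lim_{\alpha\to\infty}\limsup_{n\to\infty}d^{(n)}\big(t(n)+\alpha n\big)=0 .$$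
   Context: Colors are elements of $Q=\{1,2,3\}$ with addition modulo $3$ (so $3+1=1$). Let $V_n=\{1,\dots,n\}$ and $\Sigma_n=Q^{V_n}$. The cyclic dynamics with parameter $p\in(0,1)$ is the discrete-time Markov chain $(\sigma^n_t)_{t\ge0}$ on $\Sigma_n$ defined as follows: at each step a vertex $v\in V_n$ is chosen uniformly at random; with probability $1-p$ nothing changes, and with probability $p$ the color of $v$ is changed from $\sigma^n_t(v)$ to $\sigma^n_t(v)+1$; all other vertices keep their colors. The stationary distribution is the uniform measure $\mu_n$ on $\Sigma_n$. For probability measures on a finite set $\mathcal X$, $\|\mu-\nu\|_{\mathrm{TV}}=\max_{A\subseteq \mathcal X}|\mu(A)-\nu(A)|$. With $P_n$ the transition matrix, $d^{(n)}(t)=\max_{x\in\Sigma_n}\|P_n^t(x,\cdot)-\mu_n\|_{\mathrm{TV}}$ and $t^{(n)}_{\mathrm{mix}}(\epsilon)=\min\{t: d^{(n)}(t)\le\epsilon\}$. A non-integer time argument is replaced by its integer part (for fixed $\alpha$, the time $t(n)+\alpha n$ is positive for all large $n$). *)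

(* Defs.v *)
From HB Require Import structures.
From mathcomp Require Import all_boot all_order all_algebra.
From mathcomp Require Import all_classical all_reals all_analysis.

Set Implicit Arguments.
Unset Strict Implicit.
Unset Printing Implicit Defensive.

Import Order.TTheory GRing.Theory Num.Theory.
Import numFieldNormedType.Exports.

Local Open Scope ring_scope.

Section FiniteMarkovChain.
Context {R : realType} {X : finType}.
Implicit Types (mu nu : X -> R) (P : X -> X -> R).

(* All quantities maximised here and in [worst_tv] are nonnegative, so the
   default value 0 of the iterated maximum does not matter. *)
Definition tv_dist mu nu : R :=
  \big[Num.max/0]_(A : {set X}) `|\sum_(x in A) mu x - \sum_(x in A) nu x|.

Definition uniform_measure (x : X) : R := #|X|%:R^-1.

Fixpoint transition_pow P (t : nat) (x y : X) : R :=
  if t is t'.+1 then \sum_(z : X) P x z * transition_pow P t' z y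
  else (x == y)%:R.

Definition worst_tv P mu (t : nat) : R :=
  \big[Num.max/0]_(x : X) tv_dist (transition_pow P t x) mu.

(* The default 0 is used only if the distance never drops to eps or below. *)
Definition mixing_time P mu (eps : R) : nat :=
  if pselect (exists t, worst_tv P mu t <= eps) is left ex_t then ex_minn ex_t
  else 0%N.

End FiniteMarkovChain.

(* The colour set {1, 2, 3} with addition modulo 3 is 'Z_3, colour 3 being 0. *)
Definition config (n : nat) : finType := {ffun 'I_n -> 'Z_3}.

Definition rotate n (v : 'I_n) (s : config n) : config n :=
  [ffun w => if w == v then s w + 1 else s w].

Definition cyclic_kernel {R : realType} (p : R) (n : nat) (s s' : config n) : R :=
  \sum_(v < n) n%:R^-1 * ((1 - p) * (s' == s)%:R + p * (s' == rotate v s)%:R).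

Definition cyclic_dist {R : realType} (p : R) (n t : nat) : R :=
  worst_tv (@cyclic_kernel R p n) uniform_measure t.

Definition cyclic_tmix {R : realType} (p : R) (n : nat) (eps : R) : nat :=
  mixing_time (@cyclic_kernel R p n) uniform_measure eps.

Definition cutoff_time {R : realType} (p : R) (n : nat) : R :=
  1 / (3 * p) * n%:R * ln n%:R.

(* [Num.truncn] is the integer part of a nonnegative real, and 0 on negative
   reals; for fixed alpha the argument is positive for all large n. *)
Definition cyclic_dist_window {R : realType} (p alpha : R) (n : nat) : R :=
  cyclic_dist p n (Num.truncn (cutoff_time p n + alpha * n%:R)).

(* Main.v *)
(** The rotations commute, so the characters of (Z/3)^n diagonalise the chain:
    the eigenvalue of the frequency [k] with [m] nonzero coordinates satisfies
    |lambda|^2 <= 1 - 3x + 3x^2 with x = p m / n.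

    Upper bound: by Plancherel and Cauchy-Schwarz the squared distance is at
    most the sum of |lambda_k|^(2t) over nonzero [k].  There are C(n,m) 2^m
    frequencies of weight [m]; at time n ln n / (3p) + a n they contribute
    at most q^m with q = 2 exp(2 - 3p(1-p)(a-1)), because
    (m/n) ln n <= ln m + 1 absorbs the second order term of the eigenvalue.

    Lower bound: for the sum F of the phases exp(2 i pi y_v / 3), started at 0,
    E|F - EF|^2 <= n, and E|F|^2 = n under the uniform measure, so by Markov's
    inequality the two laws are separated as soon as |EF|^2 is large compared
    with n, which holds at time n ln n / (3p) - a n for large [a]. *)
Require Import Defs.
From mathcomp Require Import all_boot all_order all_algebra.
From mathcomp Require Import all_classical all_reals all_analysis.
From mathcomp Require Import complex ring lra.
Import Order.TTheory GRing.Theory Num.Theory.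
Import numFieldNormedType.Exports.
Local Open Scope classical_set_scope.
Local Open Scope ring_scope.

(** * Characters of (Z/3)^n *)

Section CubeRootOfUnity.
Context {R : realType}.
Local Open Scope complex_scope.
Local Notation C := R[i].

(** The squared modulus, with values in [R] so that it can be compared in the order of the reals. *)
Definition sqnorm (z : C) : R := complex.Re z ^+ 2 + complex.Im z ^+ 2.

Lemma sqnorm_ge0 (z : C) : 0 <= sqnorm z.
Proof. by rewrite addr_ge0 ?sqr_ge0. Qed.

Lemma sqnormM (y z : C) : sqnorm (y * z) = sqnorm y * sqnorm z.
Proof. by case: y z => [a b] [c d]; rewrite /sqnorm /=; ring. Qed.

Lemma sqnorm1 : sqnorm 1 = 1.
Proof. by rewrite /sqnorm /=; ring. Qed.

Lemma sqnormX (z : C) m : sqnorm (z ^+ m) = sqnorm z ^+ m.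
Proof. by elim: m => [|m IH]; rewrite ?expr0 ?sqnorm1 // !exprS sqnormM IH. Qed.

Lemma sqnorm_real (r : R) : sqnorm r%:C = r ^+ 2.
Proof. by rewrite /sqnorm /= expr0n addr0. Qed.

Lemma sqnormE (z : C) : (sqnorm z)%:C = z * conjc z.
Proof.
case: z => a b; apply/eqP; rewrite eq_complex /sqnorm /=.
by apply/andP; split; apply/eqP; ring.
Qed.

Lemma real_complexI : injective (fun r : R => r%:C).
Proof. by move=> a b []. Qed.

Lemma conjcX (z : C) m : conjc (z ^+ m) = conjc z ^+ m.
Proof. exact: (rmorphXn (@conjc R)). Qed.

Lemma conjcM (y z : C) : conjc (y * z) = conjc y * conjc z.
Proof. exact: (rmorphM (@conjc R)). Qed.

Lemma real_complexM (a b : R) : (a * b)%:C = a%:C * b%:C.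
Proof. exact: (rmorphM (real_complex R)). Qed.

(** The primitive root exp(2 i pi / 3), in Cartesian form. *)
Definition omega : C := - 2^-1 +i* (Num.sqrt 3 / 2).

Lemma omega_sqr : omega ^+ 2 = - 2^-1 -i* (Num.sqrt 3 / 2).
Proof.
have s3 : Num.sqrt (3 : R) ^+ 2 = 3 by rewrite sqr_sqrtr.
apply/eqP; rewrite expr2 eq_complex /=; apply/andP; split; apply/eqP; last by field.
have -> : - 2^-1 * - 2^-1 - Num.sqrt 3 / 2 * (Num.sqrt 3 / 2) =
  4^-1 - Num.sqrt (3 : R) ^+ 2 / 4 by field.
by rewrite s3; field.
Qed.

Lemma omega_conj : conjc omega = omega ^+ 2.
Proof. by rewrite omega_sqr. Qed.

Lemma sqnorm_omega : sqnorm omega = 1.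
Proof. by rewrite /sqnorm /= sqrrN !exprMn sqr_sqrtr //; field. Qed.

Lemma omega3 : omega ^+ 3 = 1.
Proof. by rewrite exprSr mulrC -omega_conj -sqnormE sqnorm_omega. Qed.

Lemma omega_sum : 1 + omega + omega ^+ 2 = 0.
Proof.
rewrite omega_sqr; apply/eqP; rewrite eq_complex /=.
by apply/andP; split; apply/eqP; field.
Qed.

Lemma omega_modn m : omega ^+ (m %% 3) = omega ^+ m.
Proof. by rewrite expr_mod // omega3. Qed.

(** The sum [b + 1] wraps around in ['Z_3], so the two exponents agree only modulo 3; this suffices
    since [omega] has order 3. *)
Lemma omega_mul_succ (a b : 'Z_3) :
  omega ^+ (a * (b + 1)%R) = omega ^+ a * omega ^+ (a * b).
Proof.
rewrite -exprD -omega_modn -[RHS]omega_modn; congr (_ ^+ _).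
by case: a => [[|[|[|//]]] ?]; case: b => [[|[|[|//]]] ?].
Qed.

Lemma omega_orthogonal (b c : 'Z_3) :
  \sum_(a : 'Z_3) omega ^+ (a * b) * conjc (omega ^+ (a * c)) = (3 * (b == c))%:R.
Proof.
rewrite [LHS](@big_ord_recl _ _ _ 2) !big_ord_recl big_ord0 addr0 !addrA.
rewrite !conjcX !omega_conj -!exprM -!exprD.
rewrite -!(omega_modn (_ + _)%N).
have e := omega_sum; have e' : 1 + omega ^+ 2 + omega = 0 by rewrite addrAC.
have e3 : 1 + 1 + 1 = 3 :> C by ring.
case: b => [[|[|[|//]]] ?]; case: c => [[|[|[|//]]] ?];
  rewrite /bump /= ?muln0 ?muln1 ?e ?e' //; exact: e3.
Qed.

End CubeRootOfUnity.

(** * Orthogonality and Plancherel *)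

Section Characters.
Context {R : realType} {n : nat}.
Local Open Scope complex_scope.
Local Notation C := R[i].
Implicit Types k x y : config n.

Definition chi k x : C := \prod_v omega ^+ (k v * x v).

Lemma chi_sym k x : chi k x = chi x k.
Proof. by apply: eq_bigr => v _; rewrite mulnC. Qed.

Lemma sqnorm_chi k x : sqnorm (chi k x) = 1.
Proof.
rewrite /chi; elim/big_ind: _ => [|y z hy hz|v _]; first exact: sqnorm1.
  by rewrite sqnormM hy hz mulr1.
by rewrite sqnormX sqnorm_omega expr1n.
Qed.

Lemma chi_rotate k u x : chi k (rotate u x) = omega ^+ k u * chi k x.
Proof.
rewrite /chi (bigD1 u) //= [in RHS](bigD1 u) //= ffunE eqxx mulrA.
rewrite omega_mul_succ; congr (_ * _); apply: eq_bigr => v vu.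
by rewrite ffunE (negbTE vu).
Qed.

(** The sum over [k] factors into one sum over ['Z_3] per coordinate, and a coordinate where [x] and
    [y] differ contributes a factor 0. *)
Lemma chi_orthogonal x y :
  \sum_k chi k x * conjc (chi k y) = (3 ^ n * (x == y))%:R.
Proof.
have -> : \sum_k chi k x * conjc (chi k y) =
    \sum_(k : config n) \prod_v (omega ^+ (k v * x v) * conjc (omega ^+ (k v * y v))).
  by apply: eq_bigr => k _; rewrite /chi (rmorph_prod (@conjc R)) big_split.
rewrite -(bigA_distr_bigA (fun v a => omega ^+ (nat_of_ord a * x v) *
  conjc (omega ^+ (nat_of_ord a * y v)))).
under eq_bigr => v _ do rewrite omega_orthogonal.
have [<-|xy] := eqVneq x y.
  under eq_bigr => v _ do rewrite eqxx muln1.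
  by rewrite prodr_const card_ord muln1 -natrX.
have /existsP[v /negbTE vP] : [exists v, x v != y v].
  apply: contraNT xy; rewrite negb_exists => /forallP h.
  by apply/eqP/ffunP => v; apply/eqP; move: (h v); rewrite negbK.
by rewrite muln0 (bigD1 v) //= vP muln0 mul0r.
Qed.

Lemma plancherel (f : config n -> R) :
  \sum_k sqnorm (\sum_y (f y)%:C * chi k y) = 3 ^+ n * \sum_y f y ^+ 2.
Proof.
apply: real_complexI; rewrite rmorph_sum /=.
under eq_bigr => k _.
  rewrite sqnormE (rmorph_sum (@conjc R)) big_distrlr /=.
  under eq_bigr => y _ do under eq_bigr => z _ do
    rewrite conjcM conjc_real mulrACA -rmorphM.
  over.
rewrite exchange_big /=.
under eq_bigr => y _.
  rewrite exchange_big /=.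
  under eq_bigr => z _ do rewrite -mulr_sumr chi_orthogonal.
  rewrite (bigD1 y) //= eqxx big1 ?addr0; last first.
    by move=> z zy; rewrite eq_sym (negbTE zy) muln0 mulr0.
  over.
rewrite -mulr_suml mulrC muln1 (rmorphM (real_complex R)) (rmorph_sum (real_complex R)).
by rewrite (rmorphXn (real_complex R)) (rmorph_nat (real_complex R)) natrX.
Qed.
End Characters.

(** * Spectrum and total variation *)

Section Eigenvalues.
Context {R : realType} {n : nat}.
Variable p : R.
Local Open Scope complex_scope.
Local Notation C := R[i].
Implicit Types k x y : config n.

Definition zero_config : config n := [ffun=> 0].

Definition eigenvalue k : C :=
  \sum_(v < n) (n%:R^-1)%:C * ((1 - p)%:C + p%:C * omega ^+ k v).

Lemma sum_indicatorM (a : config n) (g : config n -> C) :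
  \sum_x ((x == a)%:R)%:C * g x = g a.
Proof.
rewrite (bigD1 a) //= eqxx mul1r big1 ?addr0 // => x /negbTE ->.
by rewrite mul0r.
Qed.

(** Rotating [v] multiplies the character by [omega ^+ k v], so averaging over [v] only rescales
    it. *)
Lemma kernel_chi k x :
  \sum_y (cyclic_kernel p x y)%:C * chi k y = eigenvalue k * chi k x.
Proof.
under eq_bigr do rewrite (rmorph_sum (real_complex R)) mulr_suml.
rewrite exchange_big /= /eigenvalue mulr_suml; apply: eq_bigr => v _.
rewrite -mulrA mulrDl -mulrA -chi_rotate.
rewrite -[chi k x]sum_indicatorM -[chi k (rotate v x)]sum_indicatorM.
rewrite !mulr_sumr -big_split mulr_sumr; apply: eq_bigr => y _ /=.
rewrite (rmorphM (real_complex R)) (rmorphD (real_complex R)).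
rewrite !(rmorphM (real_complex R)) -mulrA; congr (_ * _).
by rewrite mulrDl -!mulrA.
Qed.

Lemma transition_pow_chi t k x :
  \sum_y (transition_pow (@cyclic_kernel R p n) t x y)%:C * chi k y =
  eigenvalue k ^+ t * chi k x.
Proof.
elim: t x => [|t IH] x /=.
  under eq_bigr do rewrite eq_sym.
  by rewrite sum_indicatorM expr0 mul1r.
under eq_bigr do rewrite (rmorph_sum (real_complex R)) mulr_suml.
rewrite exchange_big /= exprSr -mulrA -kernel_chi mulr_sumr; apply: eq_bigr => z _.
rewrite mulrCA -IH mulr_sumr; apply: eq_bigr => y _.
by rewrite (rmorphM (real_complex R)) mulrA.
Qed.

Lemma chi0 x : chi zero_config x = 1 :> C.
Proof. by rewrite /chi big1 // => v _; rewrite ffunE mul0n expr0. Qed.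

Lemma eigenvalue0 : (0 < n)%N -> eigenvalue zero_config = 1.
Proof.
move=> n0; rewrite /eigenvalue.
under eq_bigr do rewrite ffunE expr0 mulr1 -(rmorphD (real_complex R)) subrK mulr1.
rewrite sumr_const card_ord -(rmorphMn (real_complex R)) -mulr_natr mulVf //.
by rewrite pnatr_eq0 -lt0n.
Qed.

(** This is the trivial character, of eigenvalue 1. For [n = 0] the kernel is an empty sum, hence
    not stochastic. *)
Lemma transition_pow_sum t x : (0 < n)%N ->
  \sum_y transition_pow (@cyclic_kernel R p n) t x y = 1.
Proof.
move=> n0; apply: real_complexI; rewrite (rmorph_sum (real_complex R)) /=.
have := transition_pow_chi t zero_config x.
rewrite eigenvalue0 // expr1n chi0 mulr1 => e; rewrite -[RHS]e.
by apply: eq_bigr => y _; rewrite chi0 mulr1.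
Qed.

Lemma transition_pow_ge0 t x y : 0 <= p -> p <= 1 ->
  0 <= transition_pow (@cyclic_kernel R p n) t x y.
Proof.
move=> p0 p1; elim: t x => [|t IH] x /=; first exact: ler0n.
apply: sumr_ge0 => z _; apply: mulr_ge0 => //; apply: sumr_ge0 => v _.
by rewrite mulr_ge0 ?invr_ge0 ?ler0n // addr_ge0 // mulr_ge0 ?ler0n ?subr_ge0.
Qed.

Lemma card_config : #|config n| = (3 ^ n)%N.
Proof. by rewrite card_ffun !card_ord. Qed.

Lemma uniform_measure_sum : \sum_(x : config n) uniform_measure x = 1 :> R.
Proof.
rewrite /uniform_measure sumr_const -[LHS]mulr_natl mulfV // card_config natrX.
by rewrite expf_neq0.
Qed.

Lemma chi_sum k : \sum_y chi k y = (3 ^ n * (k == zero_config))%:R :> C.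
Proof.
rewrite -chi_orthogonal; apply: eq_bigr => y _.
by rewrite chi_sym [chi y zero_config]chi_sym chi0 conjc1 mulr1.
Qed.

(** Subtracting the uniform measure removes exactly the trivial frequency; as characters have
    modulus 1, the starting point [x] disappears. *)
Lemma transition_pow_l2 t x : (0 < n)%N ->
  3 ^+ n * \sum_y (transition_pow (@cyclic_kernel R p n) t x y
                   - uniform_measure y) ^+ 2 =
  \sum_(k | k != zero_config) sqnorm (eigenvalue k) ^+ t.
Proof.
move=> n0; rewrite -(plancherel (fun y => _ - _)) (bigD1 zero_config) //=.
have fourier k : \sum_y (transition_pow (@cyclic_kernel R p n) t x y
    - uniform_measure y)%:C * chi k y =
    eigenvalue k ^+ t * chi k x - (k == zero_config)%:R.
  under eq_bigr do rewrite (rmorphB (real_complex R)) mulrBl.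
  rewrite sumrB transition_pow_chi /uniform_measure -mulr_sumr chi_sum.
  congr (_ - _); rewrite card_config natrM mulrA.
  rewrite -(rmorph_nat (real_complex R) (3 ^ n)) -(rmorphM (real_complex R)).
  by rewrite mulVf ?mul1r // pnatr_eq0 -lt0n expn_gt0.
rewrite fourier eigenvalue0 // expr1n chi0 mulr1 eqxx subrr.
rewrite {1}/sqnorm /= expr0n addr0 add0r; apply: eq_bigr => k /negbTE k0.
by rewrite fourier k0 subr0 sqnormM sqnormX sqnorm_chi mulr1.
Qed.

End Eigenvalues.

(** * Comparing and separating probability measures *)

Section TotalVariation.
Context {R : realType} {X : finType}.
Implicit Types mu nu f : X -> R.

(** Cauchy-Schwarz, from expanding the nonnegative sum of [(N * |f x| - S) ^+ 2]. *)
Lemma sum_norm_sqr_le f :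
  (\sum_x `|f x|) ^+ 2 <= #|X|%:R * \sum_x f x ^+ 2.
Proof.
have [X0|X0] := posnP #|X|.
  rewrite X0 mul0r big_pred0 ?expr0n // => x.
  by have := max_card (pred1 x); rewrite card1 X0.
set N := #|X|%:R : R; set S : R := \sum_x `|f x|; set Q := \sum_x f x ^+ 2.
have N0 : 0 < N by rewrite ltr0n.
have : 0 <= \sum_x (N * `|f x| - S) ^+ 2 by apply: sumr_ge0 => x _; exact: sqr_ge0.
have -> : \sum_x (N * `|f x| - S) ^+ 2 = N ^+ 2 * Q - 2 * N * S * S + N * S ^+ 2.
  rewrite [X in _ - X](mulr_sumr _ _ _ _) [N ^+ 2 * Q]mulr_sumr [N * _]mulr_natl.
  rewrite -sumr_const -sumrB -big_split /=; apply: eq_bigr => x _.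
  by rewrite -[f x ^+ 2]real_normK ?num_real //; ring.
have -> : N ^+ 2 * Q - 2 * N * S * S + N * S ^+ 2 = N * (N * Q - S ^+ 2) by ring.
by rewrite pmulr_rge0 // subr_ge0.
Qed.

(** Total variation is bounded by the full l1 norm; the lost factor 1/2 only affects the window
    constant. *)
Lemma tv_dist_sqr_le mu nu :
  tv_dist mu nu ^+ 2 <= #|X|%:R * \sum_x (mu x - nu x) ^+ 2.
Proof.
apply: le_trans (sum_norm_sqr_le (fun x => mu x - nu x)).
have S0 : 0 <= \sum_x `|mu x - nu x| by apply: sumr_ge0.
have tv0 : 0 <= tv_dist mu nu by exact: bigmax_ge_id.
rewrite ler_sqr ?nnegrE //; apply: bigmax_le => // A _.
rewrite -sumrB; apply: le_trans (ler_norm_sum _ _ _) _.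
by rewrite [leRHS](bigID (mem A)) /= lerDl sumr_ge0.
Qed.

Lemma tv_dist_le1 mu nu :
  (forall x, 0 <= mu x) -> (forall x, 0 <= nu x) ->
  \sum_x mu x = 1 -> \sum_x nu x = 1 -> tv_dist mu nu <= 1.
Proof.
move=> mu0 nu0 mu1 nu1; apply: bigmax_le => // A _.
have bnd f : (forall x, 0 <= f x) -> \sum_x f x = 1 -> 0 <= \sum_(x in A) f x <= 1.
  move=> f0 <-; rewrite sumr_ge0 //= [leRHS](bigID (mem A)) /= lerDl sumr_ge0 //.
have /andP[a b] := bnd _ mu0 mu1; have /andP[c d] := bnd _ nu0 nu1.
by rewrite ler_norml; apply/andP; split; lra.
Qed.

(* If mu concentrates where [h] is small and nu where [g] is small, while
   [g + h] is bounded below, then the two measures are nearly singular. *)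
Lemma tv_dist_ge_separation mu nu (g h : X -> R) (M V : R) :
  (forall x, 0 <= mu x) -> (forall x, 0 <= nu x) ->
  (forall x, 0 <= g x) -> (forall x, 0 <= h x) ->
  \sum_x nu x = 1 -> 0 < M -> (forall x, 2 * M <= g x + h x) ->
  \sum_x mu x * h x <= V -> \sum_x nu x * g x <= V ->
  1 - 2 * V / M <= tv_dist mu nu.
Proof.
move=> mu0 nu0 g0 h0 nu1 M0 gh muh nug.
(* On [A] the function [h] exceeds [M], and off [A] the function [g] is at least [M]; Markov's
   inequality bounds both masses by [V / M]. *)
pose A := finset (fun x => g x < M).
have markov f u (B : pred X) : (forall x, 0 <= f x) -> (forall x, 0 <= u x) ->
    (forall x, B x -> M <= u x) -> \sum_x f x * u x <= V ->
    \sum_(x | B x) f x <= V / M.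
  move=> f0 u0 BM fu; rewrite ler_pdivlMr // mulr_suml; apply: le_trans _ fu.
  rewrite [leRHS](bigID B) /=; apply: le_trans (_ : _ <= \sum_(x | B x) f x * u x) _.
    by apply: ler_sum => x Bx; rewrite ler_wpM2l ?BM.
  by rewrite lerDl sumr_ge0 // => x _; rewrite mulr_ge0.
have muA : \sum_(x in A) mu x <= V / M.
  apply: (markov _ h) => // x; rewrite inE => gx; have := gh x; lra.
have nuA : \sum_(x | x \notin A) nu x <= V / M.
  by apply: (markov _ g) => // x; rewrite inE -leNgt.
move: nu1; rewrite (bigID (mem A)) /= => nu1.
apply: le_trans (le_bigmax _ _ A).
rewrite distrC; apply: le_trans (ler_norm _).
by rewrite -mulrA; lra.
Qed.
End TotalVariation.

(** * Eigenvalue moduli *)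

Section EigenvalueModulus.
Context {R : realType}.
Local Notation ReC := (@complex.Re R).
Local Notation ImC := (@complex.Im R).

Lemma Re_sum {I : finType} (F : I -> R[i]) : ReC (\sum_i F i) = \sum_i ReC (F i).
Proof. by apply: (big_morph ReC) => // -[a b] [c d]. Qed.

Lemma Im_sum {I : finType} (F : I -> R[i]) : ImC (\sum_i F i) = \sum_i ImC (F i).
Proof. by apply: (big_morph ImC) => // -[a b] [c d]. Qed.

Lemma Re_omegaX (a : 'Z_3) : ReC (omega ^+ a) = 1 - 3 / 2 * (a != 0)%:R.
Proof.
case: a => [[|[|[|//]]] i]; rewrite -[_ == 0]/(_ == _ :> nat).
- by rewrite /=; ring.
- by rewrite /=; field.
- by rewrite -[omega ^+ _]/(omega ^+ 2) omega_sqr /=; field.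
Qed.

Lemma Im_omegaX_le (a : 'Z_3) :
  `|ImC (omega ^+ a)| <= Num.sqrt 3 / 2 * (a != 0)%:R.
Proof.
have s0 : 0 <= Num.sqrt 3 / 2 :> R by rewrite divr_ge0 ?sqrtr_ge0.
case: a => [[|[|[|//]]] i]; rewrite -[_ == 0]/(_ == _ :> nat).
- by rewrite /= normr0 mulr0.
- by rewrite /= mulr1 ger0_norm.
- by rewrite -[omega ^+ _]/(omega ^+ 2) omega_sqr /= mulr1 normrN ger0_norm.
Qed.

Definition weight {n} (k : config n) : nat := #|finset (fun v => k v != 0)|.

Lemma sum_weight {n} (k : config n) : \sum_v (k v != 0)%:R = (weight k)%:R :> R.
Proof.
rewrite /weight -sum1_card natr_sum [RHS]big_mkcond /=.
by apply: eq_bigr => v _; rewrite inE; case: (k v != 0).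
Qed.

(** The real part depends only on the weight and equals [1 - 3 / 2 * x]. In the imaginary part the
    colors 1 and 2 have opposite signs and may cancel, so only an upper bound holds. *)
Lemma sqnorm_eigenvalue_le (p : R) {n} (k : config n) (x := p * (weight k)%:R / n%:R) :
  (0 < n)%N -> 0 <= p ->
  sqnorm (eigenvalue p k) <= 1 - 3 * x + 3 * x ^+ 2.
Proof.
move=> n0 p0; have N0 : n%:R != 0 :> R by rewrite pnatr_eq0 -lt0n.
have -> : 1 - 3 * x + 3 * x ^+ 2 = (1 - 3 / 2 * x) ^+ 2 + 3 * (x / 2) ^+ 2 by field.
rewrite /sqnorm /eigenvalue; apply: lerD.
  rewrite Re_sum le_eqVlt; apply/orP; left; apply/eqP; congr (_ ^+ 2).
  under eq_bigr => v _.
    rewrite (_ : ReC _ = n%:R^-1 * (1 - p * (3 / 2) * (k v != 0)%:R)); last first.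
      by have := Re_omegaX (k v); case: (omega ^+ k v) => a b /= ->; ring.
    over.
  rewrite -mulr_sumr sumrB -mulr_sumr sum_weight sumr_const card_ord.
  by rewrite /x; field.
rewrite Im_sum -(real_normK (num_real (\sum_v _))).
have -> : 3 * (x / 2) ^+ 2 = (Num.sqrt 3 / 2 * x) ^+ 2.
  by rewrite !exprMn sqr_sqrtr //; ring.
have x0 : 0 <= x by rewrite /x divr_ge0 // mulr_ge0.
have s0 : 0 <= Num.sqrt 3 / 2 :> R by rewrite divr_ge0 ?sqrtr_ge0.
rewrite ler_sqr ?nnegrE ?mulr_ge0 //.
apply: le_trans (ler_norm_sum _ _ _) _.
have -> : Num.sqrt 3 / 2 * x =
    \sum_v p / n%:R * (Num.sqrt 3 / 2 * (k v != 0)%:R).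
  by rewrite -!mulr_sumr sum_weight /x; ring.
apply: ler_sum => v _; have := Im_omegaX_le (k v).
case: (omega ^+ k v) => a b /= hb.
rewrite (_ : _ + _ = p / n%:R * b); last by ring.
have pn : 0 <= p / n%:R by rewrite divr_ge0.
by rewrite normrM (ger0_norm pn) ler_wpM2l.
Qed.

Lemma weight_eq0 {n} (k : config n) : (weight k == 0)%N = (k == zero_config).
Proof.
rewrite cards_eq0; apply/eqP/eqP => [e|->]; last first.
  by apply/setP => v; rewrite !inE ffunE eqxx.
apply/ffunP => v; rewrite ffunE; apply/eqP; apply: contraT => kv.
by move/setP/(_ v): e; rewrite !inE kv.
Qed.

(** Configurations are grouped by support, then supports by size: a support of size [m] carries two
    nonzero colors at each point. *)
Lemma sum_over_weight {n} (g : nat -> R) :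
  \sum_(k : config n) g (weight k) =
  \sum_(m < n.+1) ('C(n, m) * 2 ^ m)%:R * g m.
Proof.
pose supp (k : config n) := finset (fun v => k v != 0).
rewrite (partition_big supp predT) //=.
have fiber (D : {set 'I_n}) :
    \sum_(k | supp k == D) g (weight k) = (2 ^ #|D|)%:R * g #|D|.
  rewrite (eq_bigr (fun=> g #|D|)); last by move=> k /eqP <-.
  rewrite sumr_const mulr_natl; congr (_ *+ _).
  have two : #|predC1 (0 : 'Z_3)| = 2%N by rewrite cardC1 card_ord.
  rewrite -two -(card_pffun_on 0); apply: eq_card => k.
  rewrite -[LHS]/(supp k == D).
  apply/eqP/pfamilyP => [<-|[sk kD]].
    by split=> [|v]; [apply/fintype.subsetP => v|]; rewrite !inE.
  apply/setP => v; rewrite inE; apply/idP/idP => [kv|/kD]; last by rewrite inE.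
  by apply: (fintype.subsetP sk); rewrite inE.
under eq_bigr do rewrite fiber.
have cardlt (D : {set 'I_n}) : (#|D| < n.+1)%N.
  by rewrite ltnS -[X in (_ <= X)%N]card_ord max_card.
rewrite (partition_big (fun D => Ordinal (cardlt D)) predT) //=.
apply: eq_bigr => m _.
rewrite (eq_bigr (fun=> (2 ^ m)%:R * g m)); last by move=> D /eqP <-.
rewrite sumr_const -mulrnAl -mulr_natl -natrM; congr ((_ * _)%:R * _).
have := card_draws 'I_n m; rewrite card_ord => <-; apply: eq_card => D.
by rewrite !inE.
Qed.
End EigenvalueModulus.

(** * Upper bound *)

Section FactorialEstimates.
Context {R : realType}.

Lemma binomial_le_pow n m : 'C(n, m)%:R <= n%:R ^+ m / m`!%:R :> R.
Proof.
rewrite ler_pdivlMr ?ltr0n ?fact_gt0 // -natrM bin_ffact -natrX ler_nat.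
elim: m => [|m IH]; first by rewrite ffactn0 expn0.
by rewrite ffactnSr expnSr leq_mul // leq_subr.
Qed.

(** A weak Stirling bound; the induction step is [(1 + 1 / m) ^+ m <= expR 1]. *)
Lemma powself_le_fact m : m%:R ^+ m <= m`!%:R * expR m%:R :> R.
Proof.
elim: m => [|m IH]; first by rewrite expr0 mul1r expR0.
have [->|m0] := posnP m; first by rewrite expr1 mul1r; apply: le_trans (expR_ge1Dx 1); rewrite lerDr.
have M0 : 0 < m%:R :> R by rewrite ltr0n.
rewrite factS natrM exprS -mulrA ler_wpM2l //.
have -> : m.+1%:R ^+ m = m%:R ^+ m * (1 + m%:R^-1) ^+ m :> R.
  by rewrite -exprMn; congr (_ ^+ m); rewrite -natr1; field; rewrite gt_eqF.
rewrite -natr1 expRD mulrA; apply: ler_pM => //.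
have -> : expR 1 = expR m%:R^-1 ^+ m :> R.
  by rewrite -expRM_natl divff // gt_eqF.
by rewrite lerXn2r ?nnegrE ?expR_ge0 ?expR_ge1Dx // addr_ge0 // invr_ge0.
Qed.

(** With [r = m / n], split [ln n = ln m + ln (1 / r)] and use [r * ln (1 / r) <= 1 - r]. *)
Lemma ratio_mul_ln_le (m n : nat) : (0 < m)%N -> (m <= n)%N ->
  m%:R / n%:R * ln n%:R <= ln m%:R + 1 :> R.
Proof.
move=> m0 mn; have M0 : 0 < m%:R :> R by rewrite ltr0n.
have N0 : 0 < n%:R :> R by rewrite ltr0n (leq_trans m0).
set r := m%:R / n%:R : R.
have r0 : 0 < r by rewrite divr_gt0.
have r1 : r <= 1 by rewrite ler_pdivrMr // mul1r ler_nat.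
have -> : ln n%:R = ln m%:R + ln r^-1 :> R.
  by rewrite -lnM ?posrE ?invr_gt0 //; congr ln; rewrite /r; field; rewrite !gt_eqF.
have lnm : 0 <= ln m%:R :> R by rewrite ln_ge0 // ler1n.
have lnr : ln r^-1 <= r^-1 - 1.
  have := @le_ln1Dx R (r^-1 - 1); rewrite addrCA subrr addr0; apply.
  by rewrite ltrBrDr addNr invr_gt0.
have : r * ln r^-1 <= r * (r^-1 - 1) by rewrite ler_pM2l.
rewrite mulrBr divff ?gt_eqF // mulr1 mulrDr => h.
have : r * ln m%:R <= ln m%:R by rewrite -[leRHS]mul1r ler_wpM2r.
lra.
Qed.

Lemma geometric_sum_le (q : R) n : 0 <= q -> q <= 1 / 2 ->
  \sum_(m < n) q ^+ m.+1 <= 2 * q.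
Proof.
move=> q0 q1; elim: n => [|n IH]; first by rewrite big_ord0 mulr_ge0.
rewrite big_ord_recl expr1; under eq_bigr do rewrite exprS.
rewrite -mulr_sumr; nra.
Qed.

End FactorialEstimates.

(** * Summing the spectral bound *)

Section UpperBound.
Context {R : realType}.
Variable p : R.
Hypotheses (p_gt0 : 0 < p) (p_lt1 : p < 1).

(** The factor 2 counts nonzero colors. In the exponent 2, one unit comes from [powself_le_fact] and
    one from [ratio_mul_ln_le]. *)
Definition decay (a : R) : R := 2 * expR (2 - 3 * p * (1 - p) * (a - 1)).

Lemma weight_term_le (a : R) (n m t : nat) (x := p * m%:R / n%:R) :
  1 <= a -> (0 < m)%N -> (m <= n)%N ->
  cutoff_time p n + a * n%:R - 1 <= t%:R ->
  ('C(n, m) * 2 ^ m)%:R * (1 - 3 * x + 3 * x ^+ 2) ^+ t <= decay a ^+ m.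
Proof.
move=> a1 m0 mn ht.
have M0 : 0 < m%:R :> R by rewrite ltr0n.
have N1 : 1 <= n%:R :> R by rewrite ler1n (leq_trans m0).
have N0 : 0 < n%:R :> R by rewrite (lt_le_trans ltr01).
have L0 : 0 <= ln n%:R :> R by rewrite ln_ge0.
set r := m%:R / n%:R : R.
have r0 : 0 < r by rewrite divr_gt0.
have r1 : r <= 1 by rewrite ler_pdivrMr // mul1r ler_nat.
have xr : x = p * r by rewrite /x mulrA.
have rL := @ratio_mul_ln_le R m n m0 mn; rewrite -/r in rL.
have x0 : 0 <= x by rewrite xr mulr_ge0 // ltW.
have xp : x <= p by rewrite xr -[leRHS]mulr1 ler_pM2l.
(* Rounding the time lowers [a] by [1 / n], which is at most 1. *)
have xt : m%:R * (ln n%:R + 3 * p * (a - 1)) <= 3 * x * t%:R.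
  have : 3 * x * (cutoff_time p n + a * n%:R - 1) <= 3 * x * t%:R.
    by rewrite ler_wpM2l // mulr_ge0.
  apply: le_trans.
  have -> : 3 * x * (cutoff_time p n + a * n%:R - 1) =
      m%:R * (ln n%:R + 3 * p * (a - n%:R^-1)).
    by rewrite /cutoff_time /x; field; rewrite !gt_eqF.
  rewrite ler_pM2l // lerD2l ler_pM2l ?mulr_gt0 // lerD2l lerN2.
  by rewrite invf_le1.
have b0 : 0 <= 1 - 3 * x + 3 * x ^+ 2.
  have -> : 1 - 3 * x + 3 * x ^+ 2 = (1 - 3 / 2 * x) ^+ 2 + 3 * (x / 2) ^+ 2 by field.
  by rewrite addr_ge0 ?sqr_ge0 // mulr_ge0 ?sqr_ge0.
(* The factor [1 - x] is kept on [ln n], where the loss must be absorbed exactly, and weakened to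
   [1 - p] on the window term, where any positive rate will do. *)
have base : (1 - 3 * x + 3 * x ^+ 2) ^+ t <=
    expR (- (m%:R * (ln n%:R * (1 - x) + 3 * p * (1 - p) * (a - 1)))).
  apply: le_trans (_ : expR (- (3 * x * (1 - x))) ^+ t <= _).
    rewrite lerXn2r ?nnegrE ?expR_ge0 //.
    by apply: le_trans (expR_ge1Dx _); rewrite le_eqVlt; apply/orP; left; apply/eqP; ring.
  rewrite -expRM_natl ler_expR mulrN lerN2.
  have : (1 - x) * (m%:R * (ln n%:R + 3 * p * (a - 1))) <= (1 - x) * (3 * x * t%:R).
    by rewrite ler_wpM2l // subr_ge0 (le_trans xp) // ltW.
  have : 0 <= m%:R * (p - x) * (3 * p * (a - 1)).
    by rewrite !mulr_ge0 ?subr_ge0 // ltW.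
  nra.
have binom : 'C(n, m)%:R <= expR (m%:R * ln n%:R) / m`!%:R :> R.
  by rewrite expRM_natl lnK ?posrE // binomial_le_pow.
have mm : expR (m%:R * ln m%:R) <= m`!%:R * expR m%:R :> R.
  by rewrite expRM_natl lnK ?posrE // powself_le_fact.
have F0 : 0 < m`!%:R :> R by rewrite ltr0n fact_gt0.
have -> : decay a ^+ m = 2 ^+ m * expR (m%:R * (2 - 3 * p * (1 - p) * (a - 1))).
  by rewrite expRM_natl -exprMn.
rewrite natrM natrX mulrAC mulrC ler_pM2l ?exprn_gt0 //.
apply: le_trans (ler_pM _ _ binom base) _ => //; first exact: exprn_ge0.
rewrite mulrAC -expRD ler_pdivrMr //.
apply: le_trans (_ : expR (m%:R * ln m%:R) *
    expR (m%:R * (1 - 3 * p * (1 - p) * (a - 1))) <= _).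
  rewrite -expRD ler_expR -mulrDr -mulrN -mulrDr ler_pM2l //.
  have : p * (r * ln n%:R) <= r * ln n%:R.
    by rewrite -[leRHS]mul1r ler_wpM2r ?mulr_ge0 // ltW.
  by rewrite xr; lra.
have -> : expR (m%:R * (2 - 3 * p * (1 - p) * (a - 1))) * m`!%:R =
    m`!%:R * expR m%:R * expR (m%:R * (1 - 3 * p * (1 - p) * (a - 1))).
  by rewrite [LHS]mulrC -[RHS]mulrA -expRD; congr (_ * expR _); ring.
by rewrite ler_pM2r ?expR_gt0.
Qed.

Lemma cyclic_dist_le (a e : R) (n t : nat) : (0 < n)%N -> 1 <= a -> 0 <= e ->
  decay a <= 1 / 2 -> 2 * decay a <= e ^+ 2 ->
  cutoff_time p n + a * n%:R - 1 <= t%:R ->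
  cyclic_dist p n t <= e.
Proof.
move=> n0 a1 e0 q1 qe ht; apply: bigmax_le => // x _.
rewrite -ler_sqr ?nnegrE //; last exact: bigmax_ge_id.
apply: le_trans (tv_dist_sqr_le _ _) _; apply: le_trans _ qe.
rewrite card_config natrX transition_pow_l2 //.
pose b m : R := 1 - 3 * (p * m%:R / n%:R) + 3 * (p * m%:R / n%:R) ^+ 2.
(* The value 0 at weight 0 encodes the absence of the trivial frequency. *)
pose g (m : nat) : R := if m is 0%N then 0 else b m ^+ t.
apply: le_trans (_ : \sum_(k : config n) g (weight k) <= _).
  rewrite big_mkcond; apply: ler_sum => k _ /=; rewrite -weight_eq0 /g.
  case E : (weight k) => [|m] //=.
  have := sqnorm_eigenvalue_le p k n0 (ltW p_gt0); rewrite E => /= h.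
  have b0 := sqnorm_ge0 (eigenvalue p k).
  by rewrite lerXn2r ?nnegrE // (le_trans b0 h).
rewrite sum_over_weight big_ord_recl mulr0 add0r.
have q0 : 0 <= decay a by rewrite mulr_ge0 ?expR_ge0.
apply: le_trans (geometric_sum_le _ n q0 q1); apply: ler_sum => m _.
exact: weight_term_le a n m.+1 t a1 isT (ltn_ord m) ht.
Qed.

Lemma cyclic_dist_upper (e : R) : 0 < e -> exists a, forall n t, (0 < n)%N ->
  cutoff_time p n + a * n%:R - 1 <= t%:R -> cyclic_dist p n t <= e.
Proof.
(* From [decay a <= 2 * d] both requirements follow: [decay a <= 1 / 2] and
   [2 * decay a <= e ^+ 2]. *)
move=> e0; pose d := Num.min (1 / 4) (e ^+ 2 / 4).
have d0 : 0 < d by rewrite lt_min !divr_gt0 ?exprn_gt0.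
pose c := 3 * p * (1 - p).
have c0 : 0 < c by rewrite !mulr_gt0 // subr_gt0.
pose a := 1 + Num.max 0 ((2 - ln d) / c).
have a1 : 1 <= a by rewrite lerDl le_max lexx.
have qd : decay a <= 2 * d.
  rewrite /decay ler_pM2l // -[leRHS]lnK ?posrE // ler_expR -/c.
  have : (2 - ln d) / c <= a - 1 by rewrite /a [1 + _]addrC addrK le_max lexx orbT.
  by rewrite ler_pdivrMr //; lra.
have d1 : d <= 1 / 4 by rewrite ge_min lexx.
have d2 : d <= e ^+ 2 / 4 by rewrite ge_min lexx orbT.
exists a => n t n0 ht; apply: (cyclic_dist_le a) => //; [exact: ltW|lra|lra].
Qed.

End UpperBound.

(** * Lower bound *)

Section LowerBound.
Context {R : realType}.
Local Open Scope complex_scope.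
Local Notation C := R[i].
Local Notation ReC := (@complex.Re R).
Local Notation ImC := (@complex.Im R).

Definition unit_freq {n} (u : 'I_n) : config n := [ffun w => if w == u then 1 else 0].

(** The entry 2 stands for -1: for distinct [u] and [v] the character is the relative phase of the
    two vertices. *)
Definition diff_freq {n} (u v : 'I_n) : config n :=
  [ffun w => if w == u then 1 else if w == v then 2 else 0].

Definition phase_sum {n} (y : config n) : C := \sum_v omega ^+ y v.

Lemma chi_unit_freq {n} (u : 'I_n) y : chi (unit_freq u) y = omega ^+ y u :> C.
Proof.
rewrite /chi (bigD1 u) //= big1 ?mulr1 => [|w /negbTE wu]; last by rewrite ffunE wu.
by rewrite ffunE eqxx mul1n.
Qed.

Lemma chi_diff_freq {n} (u v : 'I_n) y : u != v ->
  chi (diff_freq u v) y = omega ^+ y u * conjc (omega ^+ y v) :> C.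
Proof.
move=> uv; have vu : v != u by rewrite eq_sym.
rewrite /chi (bigD1 u) //= (bigD1 v) //= big1 ?mulr1; last first.
  by move=> w /andP[/negbTE wu /negbTE wv]; rewrite ffunE wu wv.
rewrite !ffunE !eqxx (negbTE vu) mul1n; congr (_ * _).
by rewrite conjcX omega_conj -exprM.
Qed.

(** Expanding the square over pairs of vertices, each diagonal pair gives 1 and each of the
    [n * (n - 1)] others gives [c]. *)
Lemma phase_sum_norm {n} (f : config n -> R) (c : R) : \sum_y f y = 1 ->
  (forall u v, u != v -> \sum_y (f y)%:C * chi (diff_freq u v) y = c%:C) ->
  \sum_y f y * sqnorm (phase_sum y) = n%:R + n%:R * (n%:R - 1) * c.
Proof.
move=> f1 fc; apply: real_complexI; rewrite (rmorph_sum (real_complex R)) /=.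
under eq_bigr => y _.
  rewrite real_complexM sqnormE /phase_sum (rmorph_sum (@conjc R)).
  rewrite big_distrlr mulr_sumr /=.
  under eq_bigr do rewrite mulr_sumr.
  over.
rewrite exchange_big /=.
have diag (u : 'I_n) (y : config n) : omega ^+ y u * conjc (omega ^+ y u) = 1 :> C.
  by rewrite -sqnormE sqnormX sqnorm_omega expr1n.
under eq_bigr => u _.
  rewrite exchange_big (bigD1 u) //=.
  under [X in X + _]eq_bigr do rewrite diag mulr1.
  rewrite -(rmorph_sum (real_complex R)) f1.
  under [X in _ + X]eq_bigr => v vu.
    under eq_bigr do rewrite -chi_diff_freq 1?eq_sym //.
    rewrite fc 1?eq_sym //.
    over.
  rewrite sumr_const cardC1 card_ord.
  over.
rewrite sumr_const card_ord -!(rmorphMn (real_complex R)) -!(rmorphD (real_complex R)).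
rewrite -!(rmorphMn (real_complex R)); congr (_ %:C).
(* The count of [v != u] is a natural-number predecessor, which agrees with the real [n - 1] only
   for positive [n]. *)
case: n {f f1 fc diag} => [|n]; first by rewrite mulr0n !mul0r addr0.
by rewrite /= -[LHS]mulr_natl -[c *+ n]mulr_natl -natr1; ring.
Qed.

Variable p : R.

Lemma eigenvalueE {n} (k : config n) : (0 < n)%N ->
  eigenvalue p k = 1 - (p / n%:R)%:C * \sum_v (1 - omega ^+ k v).
Proof.
move=> n0; rewrite -[X in _ = X - _](eigenvalue0 p n0) /eigenvalue mulr_sumr -sumrB.
apply: eq_bigr => v _; rewrite ffunE expr0 real_complexM; ring.
Qed.

Lemma eigenvalue_unit_freq {n} (u : 'I_n) :
  eigenvalue p (unit_freq u) = 1 - (p / n%:R)%:C * (1 - omega).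
Proof.
rewrite eigenvalueE; last exact: leq_ltn_trans (ltn_ord u).
rewrite (bigD1 u) //= big1 ?addr0 => [|w /negbTE wu]; rewrite ffunE ?eqxx //.
by rewrite wu expr0 subrr.
Qed.

(** The two defects [1 - omega] and [1 - omega ^+ 2] are conjugate and sum to 3. *)
Lemma eigenvalue_diff_freq {n} (u v : 'I_n) : u != v ->
  eigenvalue p (diff_freq u v) = (1 - 3 * p / n%:R)%:C.
Proof.
move=> uv; have vu : v != u by rewrite eq_sym.
rewrite eigenvalueE; last exact: leq_ltn_trans (ltn_ord u).
rewrite (bigD1 u) //= (bigD1 v) //= big1 ?addr0; last first.
  by move=> w /andP[/negbTE wu /negbTE wv]; rewrite ffunE wu wv expr0 subrr.
rewrite !ffunE !eqxx (negbTE vu).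
have -> : 1 - omega ^+ (1%R : 'Z_3) + (1 - omega ^+ (2%R : 'Z_3)) = 3 :> C.
  have := @omega_sum R; rewrite -[omega ^+ (1%R : 'Z_3)]/omega -[omega ^+ (2%R : 'Z_3)]/(omega ^+ 2).
  move=> e; rewrite -[RHS]subr0 -[X in _ = _ - X]e; ring.
rewrite (rmorphB (real_complex R)) -(rmorph_nat (real_complex R) 3).
by rewrite -(rmorphM (real_complex R)); congr (_ - _%:C); ring.
Qed.

Lemma cyclic_dist_ge n t : 0 < p -> p < 1 -> (3 <= n)%N ->
  1 - 8 / (n%:R * (1 - 3 * p / n%:R) ^+ t) <= cyclic_dist p n t.
Proof.
move=> p_gt0 p_lt1 n3; have n0 : (0 < n)%N by apply: leq_trans n3.
have N0 : 0 < n%:R :> R by rewrite ltr0n.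
have N3 : 3 <= n%:R :> R by rewrite ler_nat.
set q := 1 - 3 * p / n%:R.
have q0 : 0 < q.
  rewrite subr_gt0 ltr_pdivrMr // mul1r; apply: lt_le_trans N3.
  by rewrite -[ltRHS]mulr1 ltr_pM2l.
pose P := transition_pow (@cyclic_kernel R p n) t zero_config.
have P0 y : 0 <= P y by apply: transition_pow_ge0; exact: ltW.
have P1 : \sum_y P y = 1 by exact: transition_pow_sum.
have U1 := @uniform_measure_sum R n.
pose lam : C := 1 - (p / n%:R)%:C * (1 - omega).
pose m : C := n%:R * lam ^+ t.
(* This comparison makes distinct phases negatively correlated, up to the diagonal terms, and so
   keeps the variance at most [n]. *)
have lamq : q <= sqnorm lam.
  have -> : sqnorm lam = q + 3 * (p / n%:R) ^+ 2.
    have s3 : Num.sqrt (3 : R) ^+ 2 = 3 by rewrite sqr_sqrtr.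
    rewrite /q /lam -[3 * p / n%:R]mulrA; set b := p / n%:R.
    transitivity (1 - 3 * b + 9 / 4 * b ^+ 2 + b ^+ 2 / 4 * Num.sqrt 3 ^+ 2).
      by rewrite /sqnorm /=; field.
    by rewrite s3; field.
  by rewrite lerDl mulr_ge0 // sqr_ge0.
have mE : sqnorm m = n%:R ^+ 2 * sqnorm lam ^+ t.
  by rewrite sqnormM sqnormX -(rmorph_nat (real_complex R) n) sqnorm_real.
have qt : 0 < q ^+ t by rewrite exprn_gt0.
have lamqt : q ^+ t <= sqnorm lam ^+ t.
  by rewrite lerXn2r ?nnegrE ?sqnorm_ge0 // ltW.
have lamt : 0 < sqnorm lam ^+ t := lt_le_trans qt lamqt.
have m0 : 0 < sqnorm m.
  by rewrite mE mulr_gt0 // exprn_gt0.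
have PF : \sum_y (P y)%:C * phase_sum y = m.
  under eq_bigr do rewrite mulr_sumr.
  rewrite exchange_big /=.
  under eq_bigr => v _.
    under eq_bigr do rewrite -chi_unit_freq.
    rewrite transition_pow_chi eigenvalue_unit_freq chi_sym chi0 mulr1.
    over.
  by rewrite sumr_const card_ord -[LHS]mulr_natl.
have Pg : \sum_y P y * sqnorm (phase_sum y) = n%:R + n%:R * (n%:R - 1) * q ^+ t.
  apply: phase_sum_norm => // u v uv.
  rewrite transition_pow_chi eigenvalue_diff_freq // chi_sym chi0 mulr1.
  by rewrite (rmorphXn (real_complex R)).
have Ug : \sum_(y : config n) uniform_measure y * sqnorm (phase_sum y) = n%:R :> R.
  rewrite (phase_sum_norm uniform_measure 0 U1) ?mulr0 ?addr0 // => u v uv.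
  rewrite /uniform_measure -mulr_sumr chi_sum (_ : _ == _ = false) ?muln0 ?mulr0 //.
  apply/eqP => /ffunP/(_ u); rewrite !ffunE eqxx => /eqP.
  by rewrite oner_eq0.
(* Variance equals second moment minus squared modulus of the mean [m]. *)
have Ph : \sum_y P y * sqnorm (phase_sum y - m) =
    \sum_y P y * sqnorm (phase_sum y) - sqnorm m.
  have PRe : \sum_y P y * ReC (phase_sum y) = ReC m.
    rewrite -PF Re_sum; apply: eq_bigr => y _.
    by case: (phase_sum y) => a b /=; ring.
  have PIm : \sum_y P y * ImC (phase_sum y) = ImC m.
    rewrite -PF Im_sum; apply: eq_bigr => y _.
    by case: (phase_sum y) => a b /=; ring.
  transitivity (\sum_y P y * sqnorm (phase_sum y) + \sum_y P y * sqnorm m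
    - 2 * (\sum_y P y * ReC (phase_sum y) * ReC m
           + \sum_y P y * ImC (phase_sum y) * ImC m)).
    rewrite -!big_split /= mulr_sumr -sumrB; apply: eq_bigr => y _.
    by case: (phase_sum y) (m) => a b [c d]; rewrite /sqnorm /=; ring.
  rewrite -!mulr_suml P1 PRe PIm mul1r.
  rewrite (_ : sqnorm m = ReC m ^+ 2 + ImC m ^+ 2) //; ring.
apply: le_trans (_ : tv_dist P uniform_measure <= _); last first.
  exact: (le_bigmax _ (fun x => tv_dist (transition_pow _ t x) uniform_measure)).
(* The threshold [sqnorm m / 4] comes from the parallelogram bound [|m|^2 <= 2 |F|^2 + 2 |F - m|^2],
   with [F] the phase sum. *)
apply: le_trans (tv_dist_ge_separation P uniform_measure
  (fun y => sqnorm (phase_sum y)) (fun y => sqnorm (phase_sum y - m))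
  (sqnorm m / 4) n%:R _ _ _ _ _ _ _ _ _) => //.
- rewrite lerD2l lerN2 mE.
  have -> : 2 * n%:R / (n%:R ^+ 2 * sqnorm lam ^+ t / 4) =
      8 / (n%:R * sqnorm lam ^+ t).
    by field; rewrite !gt_eqF.
  rewrite ler_pM2l // lef_pV2 ?posrE ?mulr_gt0 //.
  by rewrite ler_pM2l.
- by move=> y; rewrite invr_ge0.
- by move=> y; exact: sqnorm_ge0.
- by move=> y; exact: sqnorm_ge0.
- by rewrite divr_gt0.
- move=> y; case: (phase_sum y) (m) => a b [c d]; rewrite /sqnorm /=.
  have := sqr_ge0 (2 * a - c); have := sqr_ge0 (2 * b - d); lra.
- rewrite Ph Pg mE.
  have : n%:R ^+ 2 * q ^+ t <= n%:R ^+ 2 * sqnorm lam ^+ t.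
    by rewrite ler_pM2l ?exprn_gt0.
  have : 0 < n%:R * q ^+ t by rewrite mulr_gt0.
  lra.
- by rewrite Ug.
Qed.

(** With [y = 3p / n <= 1 / 2], one has [1 - y >= exp (- y / (1 - y))] and
    [y / (1 - y) <= y + 2 y^2]. The quadratic part costs at most [2 n y = 6p] over time [t], since
    [t y <= ln n <= n]; hence the 6. *)
Lemma pow_one_sub_ge (a : R) n t : 0 < p -> p < 1 -> (6 <= n)%N -> a <= 0 ->
  t%:R <= cutoff_time p n + a * n%:R ->
  expR (- (3 * p * a) - 6) <= n%:R * (1 - 3 * p / n%:R) ^+ t.
Proof.
move=> p_gt0 p_lt1 n6 a0 ht; have N6 : 6 <= n%:R :> R by rewrite ler_nat.
have N0 : 0 < n%:R :> R by apply: lt_le_trans N6.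
set y := 3 * p / n%:R; set L : R := ln n%:R.
have y0 : 0 < y by rewrite divr_gt0 ?mulr_gt0.
have y2 : y <= 1 / 2 by rewrite ler_pdivrMr //; lra.
have ty : t%:R * y <= L + 3 * p * a.
  apply: le_trans (_ : (cutoff_time p n + a * n%:R) * y <= _).
    by rewrite ler_pM2r.
  by rewrite le_eqVlt; apply/orP; left; apply/eqP; rewrite /cutoff_time /y /L;
    field; rewrite !gt_eqF.
have LN : L <= n%:R by apply: ltW; exact: ln_sublinear.
have z2 : y / (1 - y) <= y + 2 * y ^+ 2.
  by rewrite ler_pdivrMr; [nra|lra].
have tz : t%:R * (y / (1 - y)) <= L + 3 * p * a + 6.
  apply: le_trans (_ : t%:R * (y + 2 * y ^+ 2) <= _); first by rewrite ler_wpM2l.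
  have pa : 3 * p * a <= 0 by rewrite mulr_ge0_le0 // mulr_ge0 // ltW.
  have : t%:R * y * y <= n%:R * y by rewrite ler_pM2r //; lra.
  have -> : n%:R * y = 3 * p by rewrite /y; field; rewrite gt_eqF.
  lra.
have y1 : 0 < 1 - y by lra.
have base : expR (- (y / (1 - y))) <= 1 - y.
  rewrite expRN -[leRHS]invrK lef_pV2 ?posrE ?expR_gt0 ?invr_gt0 //.
  apply: le_trans (expR_ge1Dx _); rewrite le_eqVlt; apply/orP; left; apply/eqP.
  by field; rewrite gt_eqF.
have : expR (- (y / (1 - y))) ^+ t <= (1 - y) ^+ t.
  by rewrite lerXn2r ?nnegrE ?expR_ge0 // ltW.
rewrite -expRM_natl -(ler_pM2l N0); apply: le_trans.
rewrite -{1}[n%:R]lnK ?posrE // -expRD ler_expR -/L mulrN; lra.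
Qed.

Lemma cyclic_dist_lower (e : R) : 0 < p -> p < 1 -> 0 < e ->
  exists a, forall n t, (6 <= n)%N ->
  t%:R <= cutoff_time p n + a * n%:R -> 1 - e <= cyclic_dist p n t.
Proof.
(* Chosen so that [8 * expR (3 * p * a + 6) <= e]. *)
move=> p_gt0 p_lt1 e0; pose a := Num.min 0 ((ln (e / 8) - 6) / (3 * p)).
have a0 : a <= 0 by rewrite ge_min lexx.
have ae : 3 * p * a + 6 <= ln (e / 8).
  have : a <= (ln (e / 8) - 6) / (3 * p) by rewrite ge_min lexx orbT.
  by rewrite ler_pdivlMr ?mulr_gt0 //; lra.
exists a => n t n6 ht; apply: le_trans (cyclic_dist_ge n t p_gt0 p_lt1 _); last first.
  by apply: leq_trans n6.
rewrite lerD2l lerN2.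
have h := pow_one_sub_ge a n t p_gt0 p_lt1 n6 a0 ht.
have h0 := lt_le_trans (expR_gt0 _) h.
rewrite ler_pdivrMr //.
have : e * expR (- (3 * p * a) - 6) <= e * (n%:R * (1 - 3 * p / n%:R) ^+ t).
  by rewrite ler_pM2l.
apply: le_trans; rewrite -ler_pdivrMl //.
have -> : e^-1 * 8 = (e / 8)^-1 by field; rewrite gt_eqF.
by rewrite -[e / 8]lnK ?posrE ?divr_gt0 // -expRN ler_expR; lra.
Qed.

End LowerBound.

(** * Cutoff *)

Section LimitInferiorSuperior.
Context {R : realType}.
Implicit Types u : nat -> R.

(** The global bound makes the tail infima genuine and convergent; from [N] on they lie between [a]
    and [u n <= b]. *)
Lemma limn_inf_itv u (a b M : R) N : (forall n, 0 <= u n <= M) ->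
  (forall n, (N <= n)%N -> a <= u n <= b) -> a <= limn_inf u <= b.
Proof.
move=> uM uab.
have ubu : has_ubound (range u) by exists M => _ [n _ <-]; case/andP: (uM n).
have lbu : has_lbound (range u) by exists 0 => _ [n _ <-]; case/andP: (uM n).
have cu : cvgn (infs u) by apply/cvg_ex; eexists; exact: cvg_infs_sup.
apply/andP; split.
  apply: limr_ge => //; exists N => // n /= Nn; apply: lb_le_inf.
    by exists (u n), n => /=.
  by move=> _ [k /= nk <-]; have /andP[] := uab k (leq_trans Nn nk).
apply: limr_le => //; exists N => // n /= Nn.
apply: le_trans (_ : u n <= b); last by case/andP: (uab n Nn).
apply: ge_inf; last by exists n => /=.
by exists 0 => _ [k _ <-]; case/andP: (uM k).
Qed.

Lemma limn_sup_itv u (a b M : R) N : (forall n, 0 <= u n <= M) ->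
  (forall n, (N <= n)%N -> a <= u n <= b) -> a <= limn_sup u <= b.
Proof.
move=> uM uab.
have ubu : has_ubound (range u) by exists M => _ [n _ <-]; case/andP: (uM n).
have lbu : has_lbound (range u) by exists 0 => _ [n _ <-]; case/andP: (uM n).
have cu : cvgn (sups u) by apply/cvg_ex; eexists; exact: cvg_sups_inf.
apply/andP; split; last first.
  apply: limr_le => //; exists N => // n /= Nn; apply: ge_sup.
    by exists (u n), n => /=.
  by move=> _ [k /= nk <-]; have /andP[] := uab k (leq_trans Nn nk).
apply: limr_ge => //; exists N => // n /= Nn.
apply: le_trans (_ : a <= u n) _; first by case/andP: (uab n Nn).
apply: ub_le_sup; last by exists n => /=.
by exists M => _ [k _ <-]; case/andP: (uM k).
Qed.

Lemma ln_nat_unbounded (M : R) : exists N, forall n, (N < n)%N -> M <= ln n%:R.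
Proof.
exists (Num.truncn (expR M)) => n hn.
have : expR M < n%:R by rewrite -truncn_lt_nat ?expR_ge0.
move=> h; have n0 : 0 < n%:R :> R := lt_trans (expR_gt0 _) h.
by rewrite -ler_expR lnK ?posrE // ltW.
Qed.

End LimitInferiorSuperior.

(** * From distance bounds to mixing times *)

Section Cutoff.
Context {R : realType}.
Variable p : R.

Lemma cyclic_dist_ge0 n t : 0 <= cyclic_dist p n t.
Proof. exact: bigmax_ge_id. Qed.

Lemma cyclic_dist_le1 n t : 0 < p -> p < 1 -> (0 < n)%N -> cyclic_dist p n t <= 1.
Proof.
move=> p0 p1 n0; apply: bigmax_le => // x _; apply: tv_dist_le1.
- by move=> y; apply: transition_pow_ge0; exact: ltW.
- by move=> y; rewrite invr_ge0.
- exact: transition_pow_sum.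
- exact: uniform_measure_sum.
Qed.

Lemma cyclic_dist_window_bounded (alpha : R) : 0 < p -> p < 1 ->
  exists M, forall n, 0 <= cyclic_dist_window p alpha n <= M.
Proof.
(* The chain degenerates at [n = 0], so that single value enters the bound as it stands. *)
move=> p0 p1; exists (Num.max 1 (cyclic_dist_window p alpha 0)) => n.
rewrite cyclic_dist_ge0 le_max /=.
have [->|n0] := posnP n; first by rewrite lexx orbT.
by rewrite cyclic_dist_le1.
Qed.

Lemma window_time_ge0 (a : R) : 0 < p ->
  exists N, forall n, (N < n)%N -> 0 <= cutoff_time p n + a * n%:R.
Proof.
move=> p0; have [N HN] := ln_nat_unbounded (- (3 * p * a)); exists N => n Nn.
have -> : cutoff_time p n + a * n%:R = n%:R / (3 * p) * (ln n%:R + 3 * p * a).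
  by rewrite /cutoff_time; field; rewrite gt_eqF.
apply: mulr_ge0; first by rewrite divr_ge0 // mulr_ge0 // ltW.
by have := HN n Nn; lra.
Qed.

Lemma cyclic_tmix_near_cutoff (e : R) : 0 < p -> p < 1 -> 0 < e -> e < 1 ->
  exists K N, forall n, (N < n)%N ->
    `|(cyclic_tmix p n e)%:R - cutoff_time p n| <= K * n%:R.
Proof.
move=> p0 p1 e0 e1.
have [a ha] := cyclic_dist_upper p p0 p1 e e0.
(* With this error the lower bound is [(1 + e) / 2], strictly above [e], so no early time can be a
   mixing time. *)
have e'0 : 0 < (1 - e) / 2 by rewrite divr_gt0 // subr_gt0.
have [b hb] := cyclic_dist_lower p _ p0 p1 e'0.
have [N hN] := window_time_ge0 a p0.
exists (Num.max a (- b)), (maxn N 5) => n; rewrite gtn_max => /andP[Nn n6].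
have n0 : (0 < n)%N by apply: leq_trans n6.
have c0 := hN n Nn; have /andP[t1 t2] := truncn_itv c0.
set T := Num.truncn _ in t1 t2.
have dT : worst_tv (@cyclic_kernel R p n) uniform_measure T <= e.
  by apply: ha => //; rewrite lerBlDr natr1 ltW.
(* The time [T] is a witness, which excludes the default value of [mixing_time]. *)
rewrite /cyclic_tmix /mixing_time; case: pselect => [ex_t|[]]; last by exists T.
case: ex_minnP => m hm m_min.
have mT : m%:R <= T%:R :> R by rewrite ler_nat; apply: m_min.
have mb : cutoff_time p n + b * n%:R < m%:R.
  rewrite ltNge; apply/negP => /(hb n m n6); rewrite /cyclic_dist; lra.
have amax : a * n%:R <= Num.max a (- b) * n%:R by rewrite ler_wpM2r // le_max lexx.
have bmax : - b * n%:R <= Num.max a (- b) * n%:R.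
  by rewrite ler_wpM2r // le_max lexx orbT.
rewrite ler_norml; apply/andP; split; lra.
Qed.

Lemma cyclic_tmix_div_cutoff (e : R) : 0 < p -> p < 1 -> 0 < e -> e < 1 ->
  ((cyclic_tmix p n e)%:R / cutoff_time p n : R) @[n --> \oo] --> (1 : R).
Proof.
move=> p0 p1 e0 e1; have [K [N hN]] := cyclic_tmix_near_cutoff e p0 p1 e0 e1.
apply/cvgrPdist_le => d d0.
(* The relative error is at most [3 * p * K / ln n]; the 1 keeps [ln n] positive. *)
have [N' hN'] := ln_nat_unbounded (Num.max 1 (3 * p * K / d)).
exists (maxn N N').+1 => // n /=; rewrite gtn_max => /andP[Nn N'n].
have := hN' n N'n; rewrite ge_max => /andP[L1 L2].
have n0 : 0 < n%:R :> R by rewrite ltr0n; apply: leq_trans Nn.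
have L0 : 0 < ln n%:R :> R by apply: lt_le_trans L1.
have c0 : 0 < cutoff_time p n by rewrite /cutoff_time !mulr_gt0 ?invr_gt0 ?mulr_gt0.
have -> : 1 - (cyclic_tmix p n e)%:R / cutoff_time p n =
    - (((cyclic_tmix p n e)%:R - cutoff_time p n) / cutoff_time p n).
  by field; rewrite gt_eqF.
rewrite normrN normrM normfV (gtr0_norm c0) ler_pdivrMr //.
apply: le_trans (hN n Nn) _.
have -> : d * cutoff_time p n = d * ln n%:R / (3 * p) * n%:R.
  by rewrite /cutoff_time; field; rewrite gt_eqF.
rewrite ler_pM2r // ler_pdivlMr ?mulr_gt0 //.
by move: L2; rewrite ler_pdivrMr //; lra.
Qed.

End Cutoff.

Theorem theorem1p1 (R : realType) (p : R) (p_gt0 : 0 < p) (p_lt1 : p < 1) :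
  [/\ forall eps : R, 0 < eps -> eps < 1 ->
        ((cyclic_tmix p n eps)%:R / (cyclic_tmix p n (1 - eps))%:R : R)
          @[n --> \oo] --> (1 : R),
      limn_inf (fun n : nat => cyclic_dist_window p alpha n)
        @[alpha --> -oo%R] --> (1 : R)
    & limn_sup (fun n : nat => cyclic_dist_window p alpha n)
        @[alpha --> +oo%R] --> (0 : R)].
Proof.
split.
(* Both mixing times are asymptotic to [cutoff_time], which cancels in the quotient once it is
   positive. *)
- move=> e e0 e1.
  have h1 := cyclic_tmix_div_cutoff p e p_gt0 p_lt1 e0 e1.
  have h2 : ((cyclic_tmix p n (1 - e))%:R / cutoff_time p n : R)
      @[n --> \oo] --> (1 : R).
    by apply: cyclic_tmix_div_cutoff => //; lra.
  have h : ((cyclic_tmix p n e)%:R / cutoff_time p n /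
      ((cyclic_tmix p n (1 - e))%:R / cutoff_time p n) : R) @[n --> \oo] --> (1 : R).
    have := cvgM h1 (cvgV (oner_neq0 _) h2); rewrite invr1 mulr1; exact.
  apply: cvg_trans h; apply: near_eq_cvg.
  have [N hN] := @ln_nat_unbounded R 1; exists N.+1 => // n /= Nn.
  have n0 : 0 < n%:R :> R by rewrite ltr0n; apply: leq_trans Nn.
  have L0 : 0 < ln n%:R :> R by apply: lt_le_trans (hN n Nn).
  have c0 : 0 < cutoff_time p n by rewrite /cutoff_time !mulr_gt0 ?invr_gt0 ?mulr_gt0.
  move: (cutoff_time p n) c0 => c c0.
  by rewrite invfM invrK mulrACA mulVf ?gt_eqF // mulr1.
- apply/cvgrPdist_le => e e0.
  have [a ha] := cyclic_dist_lower p e p_gt0 p_lt1 e0.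
  exists a; split; first exact: num_real.
  move=> alpha /= alpha_a.
  have [M hM] := cyclic_dist_window_bounded p alpha p_gt0 p_lt1.
  have [N hN] := window_time_ge0 p alpha p_gt0.
  suff /andP[l1 l2] :
      1 - e <= limn_inf (fun n => cyclic_dist_window p alpha n) <= 1.
    by rewrite ger0_norm; lra.
  apply: (limn_inf_itv _ _ _ M (maxn N 5).+1) => // n.
  rewrite gtn_max => /andP[Nn n6]; rewrite cyclic_dist_le1 ?andbT //; last first.
    by apply: leq_trans n6.
  apply: ha => //; have /andP[t1 _] := truncn_itv (hN n Nn).
  by apply: le_trans t1 _; rewrite lerD2l ler_wpM2r // ltW.
- apply/cvgrPdist_le => e e0.
  have [a ha] := cyclic_dist_upper p p_gt0 p_lt1 e e0.
  exists a; split; first exact: num_real.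
  move=> alpha /= alpha_a.
  have [M hM] := cyclic_dist_window_bounded p alpha p_gt0 p_lt1.
  suff /andP[l1 l2] :
      0 <= limn_sup (fun n => cyclic_dist_window p alpha n) <= e.
    by rewrite sub0r normrN ger0_norm.
  apply: (limn_sup_itv _ _ _ M 1) => // n n0; rewrite cyclic_dist_ge0 /=.
  (* The argument is below its integer part plus one, which is the slack [- 1] in the upper
     bound. *)
  apply: ha => //; rewrite lerBlDr natr1 ltW //.
  apply: le_lt_trans (truncnS_gt _).
  by rewrite lerD2l ler_wpM2r // ltW.
Qed.
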